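(* Let $m$ be a positive even integer, let $n\in\mathbb{N}$, let $\boldsymbol{x}_1,\ldots,\boldsymbol{x}_n\in\Omega$ be pairwise distinct points, and let $y_1,\ldots,y_n\in\mathbb{R}$ be the values at $\boldsymbol{x}_1,\ldots,\boldsymbol{x}_n$ of some function in $\mathrm{C}(\Omega)$. Let $s_m$ be the associated interpolant, $s_m(\boldsymbol{x})=\mathsf{B}_m(\boldsymbol{x})\boldsymbol{c}^{m-1}$ for $\boldsymbol{x}\in\Omega$, where $\boldsymbol{c}\in\mathbb{R}^n$ is the unique solution of $\mathsf{A}_m\boldsymbol{c}^{m-1}=\boldsymbol{y}$ with $\boldsymbol{y}=(y_1,\ldots,y_n)^T$. Then $s_m$ is the minimizer (i.e. the unique solution) of the norm-minimal interpolation problem $$\min_{g\in\mathcal{B}^{m/(m-1)}}\|g\|_{\mathcal{B}^{m/(m-1)}}\quad\text{subject to}\quad g(\boldsymbol{x}_i)=y_i\ \text{ for all } i=1,2,\ldots,n.$$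
   Context: Standing setting: $\Omega\subseteq\mathbb{R}^d$ is a compact domain and $\Phi_2:\Omega\times\Omega\to\mathbb{R}$ is a continuous symmetric positive definite kernel, meaning that $\sum_{i,j=1}^{n}\Phi_2(\boldsymbol{x}_i,\boldsymbol{x}_j)c_ic_j>0$ for all $n\in\mathbb{N}$, all pairwise distinct $\boldsymbol{x}_1,\ldots,\boldsymbol{x}_n\in\Omega$ and all $\boldsymbol{c}\in\mathbb{R}^n\setminus\{0\}$. By Mercer's theorem, $$\Phi_2(\boldsymbol{z}_1,\boldsymbol{z}_2)=\sum_{k=1}^\infty\lambda_ke_k(\boldsymbol{z}_1)e_k(\boldsymbol{z}_2),\qquad \boldsymbol{z}_1,\boldsymbol{z}_2\in\Omega,$$ converging absolutely and uniformly, where $\lambda_k>0$ and $e_k$ are the (fixed) eigenvalues and continuous eigenfunctions of $\Phi_2$ (as an integral operator on $\mathrm{L}_2(\Omega)$), the $e_k$ forming an orthonormal basis of $\mathrm{L}_2(\Omega)$. Put $\phi_k:=\lambda_k^{1/2}e_k$ and assume $\sum_{k=1}^\infty|\phi_k(\boldsymbol{x})|<\infty$ for all $\boldsymbol{x}\in\Omega$. For integers $m\ge2$ define $$\Phi_m(\boldsymbol{z}_1,\ldots,\boldsymbol{z}_m):=\sum_{k=1}^\infty\prod_{i=1}^m\phi_k(\boldsymbol{z}_i),\qquad \boldsymbol{z}_1,\ldots,\boldsymbol{z}_m\in\Omega,$$ which is well-defined (and agrees with $\Phi_2$ for $m=2$). Banach space: for $1<p<\infty$, $\mathcal{B}^p$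 is the space of functions $f=\sum_{k=1}^\infty\alpha_k\phi_k$ on $\Omega$ with real coefficient sequences $\boldsymbol{\alpha}=(\alpha_k)_{k\in\mathbb{N}}$ satisfying $\|\boldsymbol{\alpha}\|_p=(\sum_k|\alpha_k|^p)^{1/p}<\infty$, normed by $\|f\|_{\mathcal{B}^p}:=\|\boldsymbol{\alpha}\|_p$. Given pairwise distinct points $\boldsymbol{x}_1,\ldots,\boldsymbol{x}_n\in\Omega$ and $\boldsymbol{c}=(c_1,\ldots,c_n)^T\in\mathbb{R}^n$, put $\mathsf{A}_m:=(\Phi_m(\boldsymbol{x}_{i_1},\ldots,\boldsymbol{x}_{i_m}))_{i_1,\ldots,i_m=1}^{n,\ldots,n}$ and $\mathsf{B}_m(\boldsymbol{x}):=(\Phi_m(\boldsymbol{x},\boldsymbol{x}_{i_1},\ldots,\boldsymbol{x}_{i_{m-1}}))_{i_1,\ldots,i_{m-1}=1}^{n,\ldots,n}$ for $\boldsymbol{x}\in\Omega$, and $$\mathsf{A}_m\boldsymbol{c}^{m-1}:=\Big(\sum_{i_2,\ldots,i_m=1}^{n,\ldots,n}\Phi_m(\boldsymbol{x}_{i_1},\boldsymbol{x}_{i_2},\ldots,\boldsymbol{x}_{i_m})c_{i_2}\cdots c_{i_m}\Big)_{i_1=1}^n\in\mathbb{R}^n,$$ $$\mathsf{B}_m(\boldsymbol{x})\boldsymbol{c}^{m-1}:=\sum_{i_1,\ldots,i_{m-1}=1}^{n,\ldots,n}\Phi_m(\boldsymbol{x},\boldsymbol{x}_{i_1},\ldots,\boldsymbol{x}_{i_{m-1}})c_{i_1}\cdots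 c_{i_{m-1}}\in\mathbb{R}.$$ For even $m$ the system $\mathsf{A}_m\boldsymbol{c}^{m-1}=\boldsymbol{y}$ has a unique solution for every $\boldsymbol{y}\in\mathbb{R}^n$, so $s_m$ is well-defined. *)

(* Defs.v *)
From HB Require Import structures.
From mathcomp Require Import all_boot all_order all_algebra.
From mathcomp Require Import all_classical all_reals all_analysis.

Set Implicit Arguments.
Unset Strict Implicit.
Unset Printing Implicit Defensive.

Import Order.TTheory GRing.Theory Num.Theory.
Import numFieldNormedType.Exports.

Local Open Scope classical_set_scope.
Local Open Scope ring_scope.

(* The product sigma-algebra on R^d (= the Borel sets), generated by the
   coordinates, as the library does for d.-tuple R. *)
Definition rV_display : measure_display -> measure_display.
Proof. exact. Qed.

Section rV_measurable.
Context {R : realType} (d : nat).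

Definition rV_coord (i : 'I_d) (x : 'rV[R]_d) : measurableTypeR R := x ord0 i.

Let rV_set0 : g_sigma_preimage rV_coord set0.
Proof. exact: sigma_algebra0. Qed.

Let rV_setC A : g_sigma_preimage rV_coord A -> g_sigma_preimage rV_coord (~` A).
Proof. exact: sigma_algebraC. Qed.

Let rV_bigcup (F : _^nat) : (forall i, g_sigma_preimage rV_coord (F i)) ->
  g_sigma_preimage rV_coord (\bigcup_i (F i)).
Proof. exact: sigma_algebra_bigcup. Qed.

HB.instance Definition _ :=
  @isMeasurable.Build (rV_display default_measure_display)
    'rV[R]_d (g_sigma_preimage rV_coord) rV_set0 rV_setC rV_bigcup.

End rV_measurable.

Section lebesgue_rV.
Context {R : realType}.

Definition rV_cons (d : nat) (p : measurableTypeR R * 'rV[R]_d) : 'rV[R]_d.+1 :=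
  row_mx (p.1 : R)%:M p.2.

Lemma rV_cons0 d (p : measurableTypeR R * 'rV[R]_d) :
  rV_cons p ord0 ord0 = p.1.
Proof.
transitivity (row_mx (p.1 : R)%:M p.2 ord0 (lshift d ord0)).
  by rewrite /rV_cons; congr (_ _ _); exact: val_inj.
by rewrite row_mxEl mxE eqxx mulr1n.
Qed.

Lemma rV_consS d (p : measurableTypeR R * 'rV[R]_d) (j : 'I_d) :
  rV_cons p ord0 (lift ord0 j) = p.2 ord0 j.
Proof.
transitivity (row_mx (p.1 : R)%:M p.2 ord0 (rshift 1 j)).
  by rewrite /rV_cons; congr (_ _ _); exact: val_inj.
by rewrite row_mxEr.
Qed.

Lemma measurable_rV_coord d (i : 'I_d) : measurable_fun setT (@rV_coord R d i).
Proof.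
move=> _ Y mY; rewrite setTI; apply: sub_sigma_algebra => /=.
rewrite -bigcup_seq/=; exists i => /=; first by rewrite mem_index_enum.
by exists Y => //; rewrite setTI.
Qed.

Lemma measurable_rV_cons d : measurable_fun setT (@rV_cons d).
Proof.
have mc (i : 'I_d.+1) : measurable_fun setT (rV_coord i \o @rV_cons d).
  have [->|[j ->]] : i = ord0 \/ exists j, i = lift ord0 j.
    by case: (unliftP ord0 i) => [j|] ->; [right; exists j|left].
  - rewrite (_ : _ \o _ = fst); first exact: measurable_fst.
    by apply/funext => -[a v]; rewrite /rV_coord /= rV_cons0.
  - rewrite (_ : _ \o _ = rV_coord j \o snd).
      exact: measurableT_comp (measurable_rV_coord j) measurable_snd.
    by apply/funext => -[a v]; rewrite /rV_coord /= rV_consS.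
have sub : g_sigma_preimage (fun i => rV_coord i \o @rV_cons d) `<=` measurable.
  apply: smallest_sub; first exact: sigma_algebra_measurable.
  rewrite -bigcup_seq => A [i _] [B mB <-]; exact: mc.
move=> _ A mA; apply: sub.
by rewrite g_sigma_preimage_comp; exists A.
Qed.

Section lebesgue_step.
Variables (d : nat) (mu : {measure set 'rV[R]_d -> \bar R}).

Definition lebesgue_step : set 'rV[R]_d.+1 -> \bar R :=
  pushforward ((@lebesgue_measure R) \x^ mu)%E (@rV_cons d).

Let step0 : lebesgue_step set0 = 0%E.
Proof. by rewrite /lebesgue_step /pushforward preimage_set0 measure0. Qed.

Let step_ge0 A : (0 <= lebesgue_step A)%E.
Proof. by rewrite /lebesgue_step /pushforward; apply: integral_ge0. Qed.

Let step_sigma_additive : semi_sigma_additive lebesgue_step.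
Proof.
move=> F mF tF mUF; rewrite /lebesgue_step /pushforward preimage_bigcup.
have mc A : measurable A -> measurable (@rV_cons d @^-1` A).
  by move=> mA; rewrite -[X in measurable X]setTI; exact: measurable_rV_cons.
apply: measure_semi_sigma_additive.
- by move=> n; apply: mc; exact: mF.
- apply/trivIsetP => /= i j _ _ ij; rewrite -preimage_setI.
  by move/trivIsetP : tF => /(_ _ _ _ _ ij) ->//; rewrite preimage_set0.
- by rewrite -preimage_bigcup; exact: mc.
Qed.

HB.instance Definition _ := isMeasure.Build _ _ _ lebesgue_step
  step0 step_ge0 step_sigma_additive.

End lebesgue_step.

(* Lebesgue measure on R^d = R x ... x R, as an iterated product measure;
   lebesgue_rV_box below characterizes it. *)
Fixpoint lebesgue_rV (d : nat) : {measure set 'rV[R]_d -> \bar R} :=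
  match d return {measure set 'rV[R]_d -> \bar R} with
  | 0%N => @dirac _ 'rV[R]_0 0 R
  | d'.+1 => lebesgue_step (lebesgue_rV d')
  end.

Lemma lebesgue_rV_box d (A : 'I_d -> set (measurableTypeR R)) :
  (forall i, measurable (A i)) ->
  lebesgue_rV d [set x | forall i, A i (x ord0 i)] =
    (\prod_(i < d) lebesgue_measure (A i))%E.
Proof.
elim: d A => [|d IH] A mA /=.
  rewrite big_ord0 diracE mem_set//= => -[]//.
rewrite big_ord_recl -IH; last by move=> i; exact: mA.
pose B := [set x : 'rV[R]_d | forall i, A (lift ord0 i) (x ord0 i)].
have mB : measurable B.
  have -> : B = \bigcap_(i in [set: 'I_d]) (rV_coord i @^-1` A (lift ord0 i)).
    by apply/seteqP; split => x /= Bx i => [_|]; exact: Bx.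
  apply: fin_bigcap_measurable => // i _; rewrite -[X in measurable X]setTI.
  exact: measurable_rV_coord.
rewrite -/B /lebesgue_step /pushforward -product_measure2E//=.
congr (product_measure2 _ _ _); apply/seteqP; split => -[a v] /=.
  move=> Ax; split => [|i]; first by have := Ax ord0; rewrite rV_cons0.
  by have := Ax (lift ord0 i); rewrite rV_consS.
move=> [Aa Av] i; have [->|[j ->]] : i = ord0 \/ exists j, i = lift ord0 j.
  by case: (unliftP ord0 i) => [j|] ->; [right; exists j|left].
- by rewrite rV_cons0.
- by rewrite rV_consS.
Qed.

End lebesgue_rV.

Section kernels.
Context {R : realType} {d : nat}.
Local Notation V := 'rV[R]_d.
Implicit Types (Omega : set V) (K : V -> V -> R) (lambda : nat -> R)
  (e phi : nat -> V -> R).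

Definition positive_definite_kernel Omega K : Prop :=
  forall (n : nat) (x : 'I_n -> V) (c : 'rV[R]_n),
    (forall i, Omega (x i)) -> injective x -> c != 0 ->
    0 < \sum_(i < n) \sum_(j < n) K (x i) (x j) * c ord0 i * c ord0 j.

Record admissible_kernel Omega K : Prop := {
  kernel_continuous : {within Omega `*` Omega, continuous (fun z => K z.1 z.2)};
  kernel_symmetric : forall z1 z2, Omega z1 -> Omega z2 -> K z1 z2 = K z2 z1;
  kernel_posdef : positive_definite_kernel Omega K }.

Definition square_integrable Omega (f : V -> R) : Prop :=
  measurable_fun Omega f /\
  (\int[lebesgue_rV d]_(x in Omega) (f x ^+ 2)%:E < +oo)%E.

Definition L2_inner Omega (f g : V -> R) : R :=
  \int[lebesgue_rV d]_(x in Omega) (f x * g x).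

Record L2_orthonormal_basis Omega e : Prop := {
  onb_L2 : forall k, square_integrable Omega (e k);
  onb_orthonormal : forall j k, L2_inner Omega (e j) (e k) = (j == k)%:R;
  onb_total : forall f, square_integrable Omega f ->
    (\int[lebesgue_rV d]_(x in Omega)
       ((f x - \sum_(k < N) L2_inner Omega f (e k) * e k x) ^+ 2)%:E)%E
      @[N --> \oo] --> 0%E }.

(* The fixed eigenpairs of the integral operator of K on L2(Omega), together
   with the absolutely and uniformly convergent expansion of K that Mercer's
   theorem provides for them. *)
Record mercer_system Omega K lambda e : Prop := {
  eigenvalue_gt0 : forall k, 0 < lambda k;
  eigenfun_continuous : forall k, {within Omega, continuous (e k)};
  eigen_equation : forall k x, Omega x ->
    \int[lebesgue_rV d]_(y in Omega) (K x y * e k y) = lambda k * e k x;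
  eigenfun_basis : L2_orthonormal_basis Omega e;
  mercer_absolute : forall z1 z2, Omega z1 -> Omega z2 ->
    cvgn (series (fun k => `|lambda k * e k z1 * e k z2|));
  mercer_uniform :
    {uniform Omega `*` Omega,
      (fun (N : nat) (z : V * V) =>
         \sum_(k < N) lambda k * e k z.1 * e k z.2) @ \oo
      --> (fun z : V * V => K z.1 z.2)} }.

Definition kernel_feature lambda e (k : nat) (x : V) : R :=
  Num.sqrt (lambda k) * e k x.

(* Phi_m; equal to K on pairs when (lambda, e) is a Mercer system of K. *)
Definition kernel_multi phi (m : nat) (z : m.-tuple V) : R :=
  limn (series (fun k => \prod_(v <- z) phi k v)).

End kernels.

(* Tensors of order m and dimension n are functions on m.-tuple 'I_n. *)
Section tensors.
Context {R : realType} {d n : nat}.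
Local Notation V := 'rV[R]_d.
Implicit Types (phi : nat -> V -> R) (x : 'I_n -> V) (c : 'rV[R]_n).

Definition kernel_tensor phi x (m : nat) (t : m.-tuple 'I_n) : R :=
  kernel_multi phi [tuple of map x t].

Definition kernel_row_tensor phi x (z : V) (q : nat) (t : q.-tuple 'I_n) : R :=
  kernel_multi phi [tuple of z :: map x t].

(* B c^q for a tensor B of order q *)
Definition tensor_contract (q : nat) (B : q.-tuple 'I_n -> R) c : R :=
  \sum_(t : q.-tuple 'I_n) B t * \prod_(i <- t) c ord0 i.

(* A c^q for a tensor A of order q.+1 *)
Definition tensor_apply (q : nat) (A : q.+1.-tuple 'I_n -> R) c : 'rV[R]_n :=
  \row_i tensor_contract (fun t : q.-tuple 'I_n => A [tuple of i :: t]) c.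

(* s_m(z) = B_m(z) c^(m-1) *)
Definition interpolant phi x (m : nat) c (z : V) : R :=
  tensor_contract (@kernel_row_tensor phi x z m.-1) c.

End tensors.

Section kernel_banach_space.
Context {R : realType} {d : nat}.
Local Notation V := 'rV[R]_d.
Variables (Omega : set V) (phi : nat -> V -> R) (p : R).
Implicit Types (f g : V -> R) (alpha : nat -> R).

Definition lp_norm alpha : \bar R := 'N[counting]_(p%:E) [EFin \o alpha].

(* Functions on Omega are total functions whose values off Omega are ignored. *)
Definition kernel_coef f alpha : Prop :=
  (lp_norm alpha < +oo)%E /\
  forall x, Omega x -> series (fun k => alpha k * phi k x) @ \oo --> f x.

Definition kernel_space : set (V -> R) := [set f | exists alpha, kernel_coef f alpha].

(* For phi k = sqrt (lambda k) * e k with (e k) orthonormal in L2(Omega), a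
   function has at most one coefficient sequence, so xget picks that one. *)
Definition kernel_norm f : R :=
  fine (lp_norm (xget (fun=> 0) [set alpha | kernel_coef f alpha])).

Context {n : nat}.
Variables (x : 'I_n -> V) (y : 'rV[R]_n).

Definition interpolation_feasible : set (V -> R) :=
  [set g | kernel_space g /\ forall i, g (x i) = y ord0 i].

Definition norm_minimal g : Prop :=
  interpolation_feasible g /\
  forall h, interpolation_feasible h -> kernel_norm g <= kernel_norm h.

Definition unique_norm_minimal s : Prop :=
  norm_minimal s /\ forall g, norm_minimal g -> forall z, Omega z -> g z = s z.

End kernel_banach_space.

(* Main.v *)
Require Import Defs.
From HB Require Import structures.
From mathcomp Require Import all_boot all_order all_algebra.
From mathcomp Require Import all_classical all_reals all_analysis.
From mathcomp Require Import measurable_realfun ring lra.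

(* Write m = q + 1 with q odd and u_k(c) = sum_i c_i phi_k(x_i), so that
   A_m c^q = y says sum_k phi_k(x_i) u_k(c)^q = y_i, and s_m has coefficients
   u_k(c)^q.  Everything rests on the strict tangent inequality
   u^m - w^m - m w^q (u - w) >= 0, with equality only at u = w.

   Summed over k, it makes F(c) = sum_k u_k(c)^m strictly convex with gradient
   m A_m c^q, whence uniqueness of c; F is positive and homogeneous of degree m,
   so F - m <y, .> is coercive and attains its minimum at a solution c.

   If beta is the coefficient sequence of a competitor, write beta_k = w_k^q, so
   that |beta_k|^(m/q) = w_k^m. The interpolation conditions give
   sum_k beta_k u_k = <c, y> = F(c), and the sum of the tangent gaps is
   q (sum_k |beta_k|^(m/q) - F(c)). It is >= 0, and 0 only if w = u.

   The coefficient sequence of a function is unique: since m/q <= 2 the difference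
   gamma of two of them is square summable, so the partial sums of
   sum_k gamma_k phi_k are bounded by sum_k gamma_k^2 + K(z, z), and dominated
   convergence against e_j gives gamma_j = 0. *)

Import Order.TTheory GRing.Theory Num.Theory.
Import numFieldNormedType.Exports.

Local Open Scope classical_set_scope.
Local Open Scope ring_scope.

(** * Tangent-line inequality for even powers *)

Section tangent.
Context {R : realDomainType}.
Implicit Types a b u w : R.

(** Induction on the exponent: the next gap is [a] times the current one plus a nonnegative multiple
    of [(a - b) ^+ 2]. *)
Lemma tangent_pow_ge0 (q : nat) a b : 0 <= a -> 0 <= b ->
  0 <= a ^+ q.+1 - b ^+ q.+1 - q.+1%:R * b ^+ q * (a - b).
Proof.
move=> a0 b0; elim: q => [|q IH]; first by rewrite !expr1 expr0; lra.
have -> : a ^+ q.+2 - b ^+ q.+2 - q.+2%:R * b ^+ q.+1 * (a - b) =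
  a * (a ^+ q.+1 - b ^+ q.+1 - q.+1%:R * b ^+ q * (a - b)) +
  q.+1%:R * b ^+ q * (a - b) ^+ 2.
  by rewrite !exprS -!natr1; ring.
apply: addr_ge0; first exact: mulr_ge0.
by apply: mulr_ge0; rewrite ?sqr_ge0 ?mulr_ge0 ?exprn_ge0.
Qed.

Definition tangent_gap (q : nat) u w : R :=
  u ^+ q.+1 - w ^+ q.+1 - q.+1%:R * w ^+ q * (u - w).

(** Passing to squares reduces arbitrary signs to the nonnegative case; the leftover term in
    [(u - w) ^+ 2] is what gives strictness. *)
Lemma tangent_gap_even (k : nat) u w : tangent_gap (k.*2.+1) u w =
  ((u ^+ 2) ^+ k.+1 - (w ^+ 2) ^+ k.+1
     - k.+1%:R * (w ^+ 2) ^+ k * (u ^+ 2 - w ^+ 2))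
  + k.+1%:R * (w ^+ 2) ^+ k * (u - w) ^+ 2.
Proof.
rewrite /tangent_gap -doubleS -!exprM !mul2n [w ^+ k.*2.+1]exprSr.
rewrite -[k.+1.*2%:R]/((k.+1.*2)%:R : R) -mul2n natrM.
ring.
Qed.

Lemma tangent_gap_ge0 {q : nat} u w : odd q -> 0 <= tangent_gap q u w.
Proof.
move=> oq; have -> : q = (q./2).*2.+1 by rewrite -[LHS]odd_double_half oq.
rewrite tangent_gap_even; apply: addr_ge0.
  by apply: tangent_pow_ge0; exact: sqr_ge0.
by rewrite mulr_ge0 ?sqr_ge0// mulr_ge0// exprn_ge0// sqr_ge0.
Qed.

Lemma tangent_gap_eq0 {q : nat} {u w} : odd q -> tangent_gap q u w = 0 -> u = w.
Proof.
move=> oq; have -> : q = (q./2).*2.+1 by rewrite -[LHS]odd_double_half oq.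
(* The weight of the square may vanish at [w = 0]; there the gap is just [u ^+ q.+1]. *)
have [->|w0] := eqVneq w 0.
  rewrite /tangent_gap !expr0n/= mulr0 mul0r !subr0 => /eqP.
  by rewrite expf_eq0/= => /eqP.
move=> /eqP; rewrite tangent_gap_even paddr_eq0; last 2 first.
  by apply: tangent_pow_ge0; exact: sqr_ge0.
  by rewrite mulr_ge0 ?sqr_ge0// mulr_ge0// exprn_ge0// sqr_ge0.
move=> /andP[_]; rewrite mulf_eq0 sqrf_eq0 subr_eq0 => /orP[|/eqP//].
by rewrite mulf_eq0 pnatr_eq0 -exprM expf_eq0 (negbTE w0) andbF.
Qed.

End tangent.

(** * Convergent real series and series with nonnegative terms *)

Section series_lemmas.
Context {R : realType}.
Implicit Types (u v : nat -> R) (l r s : R).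

Lemma eq_cvg_series {u v l} : u =1 v -> series u @ \oo --> l ->
  series v @ \oo --> l.
Proof. by move=> /funext ->. Qed.

Lemma cvg_series_unique {u l r} : series u @ \oo --> l -> series u @ \oo --> r ->
  l = r.
Proof. exact: cvg_unique. Qed.

Lemma cvg_seriesD {u v l r} : series u @ \oo --> l -> series v @ \oo --> r ->
  series (fun k => u k + v k) @ \oo --> l + r.
Proof.
move=> ul vr; have -> : series (fun k => u k + v k) = series u \+ series v.
  by rewrite -[RHS]seriesD.
exact: cvgD.
Qed.

Lemma cvg_seriesZ s {u l} : series u @ \oo --> l ->
  series (fun k => s * u k) @ \oo --> s * l.
Proof.
move=> ul; have -> : series (fun k => s * u k) = (fun n => s * series u n).
  by apply/funext => n; rewrite /series/= mulr_sumr.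
exact: cvgM (cvg_cst s) ul.
Qed.

Lemma cvg_seriesB {u v l r} : series u @ \oo --> l -> series v @ \oo --> r ->
  series (fun k => u k - v k) @ \oo --> l - r.
Proof.
move=> ul vr; rewrite -mulN1r; have := cvg_seriesD ul (cvg_seriesZ (-1) vr).
by apply: eq_cvg_series => k; rewrite mulN1r.
Qed.

Lemma cvg_series_sum {I : Type} (t : seq I) {u : I -> nat -> R} {l : I -> R} :
  (forall i, series (u i) @ \oo --> l i) ->
  series (fun k => \sum_(i <- t) u i k) @ \oo --> \sum_(i <- t) l i.
Proof.
move=> ul; elim: t => [|i t IH].
  rewrite big_nil; apply: (@eq_cvg_series (fun k => 0 * 0)).
    by move=> k; rewrite big_nil mul0r.
  rewrite [X in series X](_ : _ = fun=> 0); last by apply/funext => k; rewrite mul0r.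
  rewrite (_ : series _ = fun=> 0); first exact: cvg_cst.
  by apply/funext => n; rewrite /series/= big1.
rewrite big_cons; apply: eq_cvg_series _ (cvg_seriesD (ul i) IH).
by move=> k; rewrite big_cons.
Qed.

Lemma cvg_series_ge_term {u l} k : (forall k, 0 <= u k) ->
  series u @ \oo --> l -> u k <= l.
Proof.
move=> u0 ul; apply: (@le_trans _ _ (series u k.+1)).
  by rewrite /series/= big_nat_recr//= lerDr sumr_ge0.
rewrite -(cvg_lim _ ul)//; apply: nondecreasing_cvgn_le; last by apply/cvg_ex; exists l.
exact: nondecreasing_series.
Qed.

Lemma cvg_series_ge0 {u l} : (forall k, 0 <= u k) -> series u @ \oo --> l -> 0 <= l.
Proof. by move=> u0 ul; exact: le_trans (u0 0%N) (cvg_series_ge_term 0 u0 ul). Qed.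

Lemma cvg_series_eq0 {u} : (forall k, 0 <= u k) -> series u @ \oo --> 0 ->
  forall k, u k = 0.
Proof.
by move=> u0 ul k; apply/le_anti; rewrite u0 andbT (cvg_series_ge_term k u0 ul).
Qed.

Lemma is_cvg_series_le {u v} : (forall k, `|u k| <= v k) -> cvgn (series v) ->
  cvgn (series u).
Proof.
move=> uv cv; apply: normed_cvg.
by apply: (series_le_cvg _ _ uv cv) => // k; exact: le_trans (uv k).
Qed.

End series_lemmas.

Lemma ler_coord_norm {R : realType} {n : nat} (c : 'rV[R]_n) (i : 'I_n) :
  `|c ord0 i| <= `|c|.
Proof.
rewrite [leRHS]/Num.norm /= mx_normrE; apply/bigmax_geP.
by right => /=; exists (ord0, i).
Qed.

(** * Existence and uniqueness for the system [P c = y] *)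

Section power_system.
Context {R : realType} {n q : nat}.
Implicit Types (b c h y : 'rV[R]_n) (a : nat -> 'I_n -> R).

Definition row_dot b c : R := \sum_i c ord0 i * b ord0 i.

(** With [a k i] standing for phi_k(x_i), this is u_k(c). *)
Definition lincomb a c k : R := \sum_i c ord0 i * a k i.

Lemma row_dotBl b c h : row_dot (b - c) h = row_dot b h - row_dot c h.
Proof. by rewrite /row_dot -sumrB; apply: eq_bigr => i _; rewrite !mxE; ring. Qed.

Lemma row_dotBr b c h : row_dot h (b - c) = row_dot h b - row_dot h c.
Proof. by rewrite /row_dot -sumrB; apply: eq_bigr => i _; rewrite !mxE; ring. Qed.

Lemma row_dotZr (t : R) b c : row_dot b (t *: c) = t * row_dot b c.
Proof. by rewrite /row_dot mulr_sumr; apply: eq_bigr => i _; rewrite !mxE; ring. Qed.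

Lemma row_dot_eq0 b : row_dot b b <= 0 -> b = 0.
Proof.
move=> bb; apply/rowP => i; rewrite mxE; apply/eqP; rewrite -sqrf_eq0.
have b0 j : true -> 0 <= b ord0 j * b ord0 j by rewrite -expr2 sqr_ge0.
have /eqP : row_dot b b = 0 by apply/le_anti; rewrite bb sumr_ge0.
by rewrite psumr_eq0// => /allP /(_ i (mem_index_enum _)); rewrite -expr2.
Qed.

Lemma lincombZ a t c k : lincomb a (t *: c) k = t * lincomb a c k.
Proof. by rewrite /lincomb mulr_sumr; apply: eq_bigr => i _; rewrite mxE mulrA. Qed.

Lemma lincombB a b c k : lincomb a (b - c) k = lincomb a b k - lincomb a c k.
Proof. by rewrite /lincomb -sumrB; apply: eq_bigr => i _; rewrite !mxE mulrBl. Qed.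

Variables (a : nat -> 'I_n -> R) (P : 'rV[R]_n -> 'rV[R]_n).
Hypothesis q_odd : odd q.
Hypothesis a_inj : forall c, (forall k, lincomb a c k = 0) -> c = 0.
Hypothesis P_cvg : forall c i,
  series (fun k => a k i * lincomb a c k ^+ q) @ \oo --> P c ord0 i.

(** The finite sum over coordinates moves inside the series. For [b = c] the limit [row_dot (P c) c]
    is the energy F(c). *)
Lemma cvg_row_dot b c :
  series (fun k => lincomb a b k * lincomb a c k ^+ q) @ \oo --> row_dot (P c) b.
Proof.
have := cvg_series_sum (index_enum _)
  (fun i => cvg_seriesZ (b ord0 i) (P_cvg c i)).
apply: eq_cvg_series => k /=.
by rewrite /lincomb mulr_suml; apply: eq_bigr => i _; rewrite mulrA.
Qed.


(** The limit is the tangent gap of the energy itself, with [q.+1%:R *: P c] as its gradient at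
    [c]. *)
Lemma cvg_tangent_gap b c :
  series (fun k => tangent_gap q (lincomb a b k) (lincomb a c k)) @ \oo -->
  row_dot (P b) b - row_dot (P c) c - q.+1%:R * row_dot (P c) (b - c).
Proof.
rewrite row_dotBr; have := cvg_seriesB
    (cvg_seriesB (cvg_row_dot b b) (cvg_row_dot c c))
    (cvg_seriesZ (q.+1%:R) (cvg_seriesB (cvg_row_dot b c) (cvg_row_dot c c))).
apply: eq_cvg_series => k; rewrite /tangent_gap !exprS; ring.
Qed.

Lemma tangent_row_dot b c :
  0 <= row_dot (P b) b - row_dot (P c) c - q.+1%:R * row_dot (P c) (b - c).
Proof.
apply: (cvg_series_ge0 (u := fun k =>
  tangent_gap q (lincomb a b k) (lincomb a c k))) => [k|].
  exact: tangent_gap_ge0.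
exact: cvg_tangent_gap.
Qed.

(** Nonnegative gaps with sum zero all vanish, so [b] and [c] have the same u_k, and [a_inj]
    identifies them. *)
Lemma tangent_row_dot_eq b c :
  row_dot (P b) b - row_dot (P c) c - q.+1%:R * row_dot (P c) (b - c) <= 0 ->
  b = c.
Proof.
move=> bc; have {bc}/le_anti bc0 :
    row_dot (P b) b - row_dot (P c) c - q.+1%:R * row_dot (P c) (b - c) <= 0 <=
    row_dot (P b) b - row_dot (P c) c - q.+1%:R * row_dot (P c) (b - c).
  by rewrite bc tangent_row_dot.
have := cvg_tangent_gap b c; rewrite bc0 => /cvg_series_eq0 gap0.
apply/eqP; rewrite -subr_eq0; apply/eqP/a_inj => k; rewrite lincombB.
apply/eqP; rewrite subr_eq0; apply/eqP/(tangent_gap_eq0 q_odd)/gap0 => {}k.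
exact: tangent_gap_ge0.
Qed.

(** The gaps from [b] to [c] and from [c] to [b] add up to (q+1) <P b - P c, b - c>, which is 0
    here; both being nonnegative, both vanish. *)
Lemma power_system_unique b c : P b = P c -> b = c.
Proof.
move=> Pbc; apply: tangent_row_dot_eq.
have := tangent_row_dot c b; have := tangent_row_dot b c; rewrite !Pbc !row_dotBr.
have : (0 : R) < q.+1%:R by [].
nra.
Qed.

Lemma row_dot_energy_ge0 c : 0 <= row_dot (P c) c.
Proof.
apply: cvg_series_ge0 (cvg_row_dot c c) => k.
by rewrite -exprS exprn_even_ge0//= negbK.
Qed.

Lemma row_dot_energy_gt0 c : c != 0 -> 0 < row_dot (P c) c.
Proof.
move=> c0; rewrite lt_def row_dot_energy_ge0 andbT; apply: contra_neq c0 => Pc0.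
apply: a_inj => k; have := cvg_row_dot c c; rewrite Pc0 => /cvg_series_eq0 u0.
apply/eqP; have : lincomb a c k * lincomb a c k ^+ q = 0.
  by apply: u0 => {}k; rewrite -exprS exprn_even_ge0//= negbK.
by rewrite -exprS => /eqP; rewrite expf_eq0.
Qed.

Lemma row_dot_energyZ (t : R) c :
  row_dot (P (t *: c)) (t *: c) = t ^+ q.+1 * row_dot (P c) c.
Proof.
apply: cvg_series_unique (cvg_row_dot (t *: c) (t *: c)) _.
have := cvg_seriesZ (t ^+ q.+1) (cvg_row_dot c c).
apply: eq_cvg_series => k.
by rewrite !lincombZ exprMn exprS; ring.
Qed.

Hypothesis P_continuous : forall i, continuous (fun c => P c ord0 i).

Lemma row_dot_energy_continuous : continuous (fun c => row_dot (P c) c).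
Proof.
apply: continuous_big => [|i _ c]; first exact: add_continuous.
exact: cvgM (@coord_continuous R 1 n ord0 i c) (P_continuous i c).
Qed.

Lemma row_dot_continuous y : continuous (fun c => row_dot y c).
Proof.
apply: continuous_big => [|i _ c]; first exact: add_continuous.
exact: cvgM (@coord_continuous R 1 n ord0 i c) (cvg_cst (y ord0 i)).
Qed.

Lemma row_dot_bound y c : row_dot y c <= (\sum_i `|y ord0 i|) * `|c|.
Proof.
rewrite /row_dot mulr_suml; apply: ler_sum => i _.
rewrite (le_trans (ler_norm _))// normrM mulrC ler_wpM2l//.
exact: ler_coord_norm.
Qed.

(** By homogeneity of degree [q.+1], the minimum of the energy on the unit sphere serves as [mu];
    the sphere is compact and avoids 0. *)
Lemma energy_coercive : exists2 mu : R, 0 < mu &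
  forall c, mu * `|c| ^+ q.+1 <= row_dot (P c) c.
Proof.
(* Without a nonzero vector the sphere is empty, and any positive constant will do. *)
have [[c0 c0n0]|nc] := pselect (exists c : 'rV[R]_n, c != 0); last first.
  exists 1 => // c; have -> : c = 0.
    by apply/eqP; apply: contrapT => /negP c0; apply: nc; exists c.
  by rewrite normr0 expr0n/= mulr0 row_dot_energy_ge0.
pose S := [set c : 'rV[R]_n | `|c| = 1].
have normS c : c != 0 -> S (`|c|^-1 *: c).
  by move=> cn0; rewrite /S/= normrZ normfV normr_id mulVf// normr_eq0.
have [|||c1 c1S c1min] := @EVT_min_rV R n (fun c => row_dot (P c) c) S.
- by exists (`|c0|^-1 *: c0); exact: normS.
- apply: bounded_closed_compact.
    by exists 1; split=> // x x1 c /= ->; rewrite ltW.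
  apply: (closed_comp (f := fun c : 'rV[R]_n => `|c|)) (@closed_eq _ 1).
  by move=> c _; exact: norm_continuous.
- by apply: continuous_subspaceT; exact: row_dot_energy_continuous.
exists (row_dot (P c1) c1).
  apply: row_dot_energy_gt0; apply/eqP => c10.
  by move: c1S; rewrite inE /S/= c10 normr0 => /esym/eqP; rewrite oner_eq0.
move=> c; have [->|cn0] := eqVneq c 0.
  by rewrite normr0 expr0n/= mulr0 row_dot_energy_ge0.
have -> : c = `|c| *: (`|c|^-1 *: c).
  by rewrite scalerA divff ?normr_eq0// scale1r.
rewrite row_dot_energyZ mulrC normrZ normr_id.
have := normS _ cn0; rewrite /S/= => Sc; rewrite Sc mulr1 ler_wpM2l ?exprn_ge0//.
by apply: c1min; rewrite inE.
Qed.

(** Outside a large ball the functional is nonnegative, while it is 0 at the origin; a minimizer on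
    the ball is therefore global. *)
Lemma energy_minimizer y : exists c, forall b,
  row_dot (P c) c - q.+1%:R * row_dot y c <= row_dot (P b) b - q.+1%:R * row_dot y b.
Proof.
have [mu mu0 muP] := energy_coercive.
pose M := q.+1%:R * \sum_i `|y ord0 i|.
have M0 : 0 <= M by rewrite mulr_ge0// sumr_ge0.
pose G c := row_dot (P c) c - q.+1%:R * row_dot y c.
(* For [|b| > r] the summand [M / mu] gives M <= mu |b| and the summand 1 gives |b| <= |b|^q, so the
   energy dominates the linear term. *)
pose r := M / mu + 1; have r1 : 1 <= r by rewrite lerDr divr_ge0// ltW.
have P00 : row_dot (P 0) 0 = 0 by rewrite /row_dot big1// => i _; rewrite mxE mul0r.
have G0 : G 0 = 0.
  by rewrite /G P00 /row_dot big1 ?mulr0 ?subrr// => i _; rewrite mxE mul0r.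
have Gout b : r < `|b| -> 0 <= G b.
  move=> rb; rewrite subr_ge0 (le_trans _ (muP b))//.
  apply: (@le_trans _ _ (M * `|b|)).
    by rewrite -mulrA ler_wpM2l// row_dot_bound.
  have b1 : 1 <= `|b| by rewrite (le_trans r1)// ltW.
  rewrite exprSr mulrA ler_wpM2r//.
  apply: (@le_trans _ _ (mu * `|b|)).
    by rewrite mulrC -ler_pdivrMr// (le_trans _ (ltW rb))// lerDl.
  by apply: ler_wpM2l; [exact: ltW|rewrite ler_eXnr// odd_gt0].
have [|||c cB cmin] := @EVT_min_rV R n G [set c | `|c| <= r].
- by exists 0 => /=; rewrite normr0 (le_trans _ r1).
- apply: bounded_closed_compact.
    exists r; split; first exact: num_real.
    by move=> x rx b /= br; rewrite (le_trans br)// ltW.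
  apply: (closed_comp (f := fun c : 'rV[R]_n => `|c|)) (@closed_le _ r).
  by move=> c _; exact: norm_continuous.
- apply: continuous_subspaceT => c; 
  exact: (cvgB (row_dot_energy_continuous c)
    (cvgM (cvg_cst (q.+1%:R : R)) (row_dot_continuous y c))).
exists c => b; have [br|/Gout Gb] := leP `|b| r; first by apply: cmin; rewrite inE.
apply: le_trans Gb; rewrite -/(G c) -G0; apply: cmin.
by rewrite inE/= normr0 (le_trans _ r1).
Qed.

(** The first-order condition is reached without derivatives. At [c - t *: g], with [g] the
    residual, minimality of [c] and the tangent inequality based at that point give
    [row_dot (P (c - t *: g) - y) g <= 0]; as t tends to 0 this becomes [row_dot g g <= 0]. *)
Lemma power_system_solvable y : exists c, P c = y.
Proof.
have [c cmin] := energy_minimizer y; exists c; apply/eqP; rewrite -subr_eq0.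
set g := P c - y; apply/eqP/row_dot_eq0.
(* The step sizes 1/(k+1) tend to 0 and are positive, so they can be cancelled. *)
pose ct k := c - harmonic k *: g.
have ct_le k : row_dot (P (ct k) - y) g <= 0.
  have := cmin (ct k); have := tangent_row_dot c (ct k).
  have -> : c - ct k = harmonic k *: g by rewrite /ct opprB addrCA subrr addr0.
  have -> : row_dot y (ct k) = row_dot y c - harmonic k * row_dot y g.
    by rewrite row_dotBr row_dotZr.
  rewrite row_dotZr row_dotBl.
  have h0 : (0 : R) < harmonic k by rewrite /harmonic/= invr_gt0.
  have q0 : (0 : R) < q.+1%:R by [].
  move=> h1 h2; rewrite -(pmulr_rle0 _ h0) -(pmulr_rle0 _ q0).
  lra.
have ct_cvg : ct @ \oo --> c.
  rewrite -[X in _ --> X]subr0 -[X in _ - X](scale0r g).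
  by apply: cvgB; [exact: cvg_cst|apply: cvgZ; [exact: cvg_harmonic|exact: cvg_cst]].
have lim_ct : (fun k => row_dot (P (ct k) - y) g) @ \oo --> row_dot g g.
  apply: cvg_big => [|i _]; first exact: add_continuous.
  apply: cvgM; first exact: cvg_cst.
  rewrite /g !mxE; under eq_fun do rewrite !mxE.
  exact: (cvgB (cvg_comp _ _ ct_cvg (P_continuous i c)) (cvg_cst _)).
by apply: cvgr_to_le lim_ct _; exact: nearW.
Qed.

End power_system.

(** Distributing a product of [q] equal sums gives a sum over functions from ['I_q] to ['I_n],
    reindexed here by tuples. *)
Lemma sum_tuple_prod (R : comNzRingType) (n q : nat) (g : 'I_n -> R) :
  \sum_(t : q.-tuple 'I_n) \prod_(i <- t) g i = (\sum_i g i) ^+ q.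
Proof.
rewrite -[q in RHS]card_ord -prodr_const (bigA_distr_bigA (fun _ j => g j)).
rewrite (reindex (@finfun_of_tuple 'I_n q)) /=; last first.
  by exists (@tuple_of_finfun 'I_n q) => t _;
    rewrite ?finfun_of_tupleK ?tuple_of_finfunK.
by apply: eq_bigr => t _; rewrite big_tuple; apply: eq_bigr => i _; rewrite ffunE.
Qed.

(** * Contracted kernel tensors as series in the features *)

Section kernel_tensors.
Context {R : realType} {d n : nat}.
Local Notation V := 'rV[R]_d.
Variables (phi : nat -> V -> R).

Definition absolutely_summable_at (z : V) : Prop :=
  cvgn (series (fun k => `|phi k z|)).

(** Terms of a convergent series are bounded. One absolutely summable factor next to such a product
    then makes the series of Phi_m converge. *)
Lemma bounded_prod (s : seq V) : (forall v, v \in s -> absolutely_summable_at v) ->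
  exists M : R, forall k, `|\prod_(v <- s) phi k v| <= M.
Proof.
elim: s => [|v s IH] sv; first by exists 1 => k; rewrite big_nil normr1.
have [w ws|M HM] := IH; first by apply: sv; rewrite inE ws orbT.
have [N [_ HN]] := cvg_series_bounded (sv v (mem_head _ _)).
exists ((N + 1) * M) => k; rewrite big_cons normrM ler_pM//.
by rewrite -[leLHS]normr_id; apply: HN; rewrite ?ltrDl.
Qed.

Lemma is_cvg_series_prod (z : V) (s : seq V) : absolutely_summable_at z ->
  (forall v, v \in s -> absolutely_summable_at v) ->
  cvgn (series (fun k => \prod_(v <- z :: s) phi k v)).
Proof.
move=> cz /bounded_prod[M HM].
apply: (is_cvg_series_le _ (cvgP _ (cvg_seriesZ M cz))) => k.
by rewrite big_cons normrM mulrC ler_wpM2r.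
Qed.

Variable x : 'I_n -> V.
Hypothesis x_summable : forall i, absolutely_summable_at (x i).

(** The finite sum over tuples moves inside the series, where it factors by [sum_tuple_prod]. This
    exhibits u_k(c)^q as the coefficients of the interpolant. *)
Lemma cvg_tensor_contract (z : V) (q : nat) (c : 'rV[R]_n) :
  absolutely_summable_at z ->
  series (fun k => phi k z * lincomb (fun k i => phi k (x i)) c k ^+ q) @ \oo -->
    tensor_contract (kernel_row_tensor phi x z (q := q)) c.
Proof.
move=> cz; rewrite /tensor_contract.
have tc (t : q.-tuple 'I_n) : series (fun k => \prod_(i <- t) c ord0 i *
    \prod_(v <- [tuple of z :: map x t]) phi k v) @ \oo -->
    \prod_(i <- t) c ord0 i * kernel_row_tensor phi x z t.
  apply: cvg_seriesZ; apply: is_cvg_series_prod => // v /mapP[i _ ->].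
  exact: x_summable.
under [X in _ --> X]eq_bigr do rewrite mulrC.
have := cvg_series_sum (index_enum _) tc; apply: eq_cvg_series => k.
rewrite /lincomb -sum_tuple_prod mulr_sumr; apply: eq_bigr => t _.
by rewrite big_cons big_map big_split/=; ring.
Qed.

Lemma tensor_applyE (q : nat) (c : 'rV[R]_n) (i : 'I_n) :
  tensor_apply (kernel_tensor phi x (m := q.+1)) c ord0 i =
  tensor_contract (kernel_row_tensor phi x (x i) (q := q)) c.
Proof. by rewrite mxE. Qed.

Lemma tensor_contract_continuous (q : nat) (B : q.-tuple 'I_n -> R) :
  continuous (tensor_contract B).
Proof.
apply: continuous_big => [|t _ c]; first exact: add_continuous.
have prod_cont : continuous (fun c : 'rV[R]_n => \prod_(i <- t) c ord0 i).
  apply: continuous_big => [|i _ b]; first exact: mul_continuous.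
  exact: (@coord_continuous R 1 n ord0 i b).
exact: cvgM (cvg_cst (B t)) (prod_cont c).
Qed.

End kernel_tensors.

(** * The l^p norm of coefficient sequences, and odd roots *)

Section lp_norms.
Context {R : realType}.
Implicit Types (u alpha : nat -> R) (l p : R).

Lemma nneseries_fin_cvg {u} : (forall k, 0 <= u k) ->
  (\sum_(0 <= k <oo) (u k)%:E < +oo)%E -> cvgn (series u).
Proof.
move=> u0 uoo; apply: nondecreasing_is_cvgn; first exact: nondecreasing_series.
exists (fine (\sum_(0 <= k <oo) (u k)%:E)) => _ [N _ <-].
rewrite -lee_fin fineK.
  by rewrite -sumEFin; apply: nneseries_lim_ge => k _ _; rewrite lee_fin.
by rewrite ge0_fin_numE//; apply: nneseries_ge0 => k _ _; rewrite lee_fin.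
Qed.

Lemma nneseries_EFin {u l} : series u @ \oo --> l ->
  (\sum_(0 <= k <oo) (u k)%:E = l%:E)%E.
Proof.
move=> ul; apply: cvg_lim => //.
rewrite (_ : (fun _ => _) = EFin \o series u).
  by apply: cvg_EFin => //; exact: nearW.
by apply/funext => N /=; rewrite sumEFin.
Qed.

Lemma lp_normE {p alpha l} : 0 < p ->
  series (fun k => `|alpha k| `^ p) @ \oo --> l ->
  lp_norm p alpha = (l `^ p^-1)%:E.
Proof.
move=> p0 al; rewrite /lp_norm Lnorm_counting//.
by rewrite (nneseries_EFin al) poweR_EFin.
Qed.

Lemma lp_norm_lty {p alpha} : 0 < p -> (lp_norm p alpha < +oo)%E ->
  cvgn (series (fun k => `|alpha k| `^ p)).
Proof.
move=> p0; rewrite /lp_norm Lnorm_counting// => aoo.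
apply: nneseries_fin_cvg => [k|]; first exact: powR_ge0.
rewrite ltey; apply: contraTN aoo => /eqP Soo.
by rewrite -leNgt Soo poweRyr// invr_eq0 gt_eqF.
Qed.

(** As [q] is odd, the root of |a| can be given the sign of [a]; the even power [q.+1] removes it
    again. *)
Lemma odd_root {q : nat} (a : R) : odd q ->
  exists w, w ^+ q = a /\ w ^+ q.+1 = `|a| `^ (q.+1%:R / q%:R).
Proof.
move=> oq; have q0 : (q%:R : R) != 0 by rewrite pnatr_eq0 -lt0n odd_gt0.
pose r := `|a| `^ q%:R^-1; have r0 : 0 <= r by exact: powR_ge0.
have rq : r ^+ q = `|a| by rewrite -powR_mulrn// -powRrM mulVf// powRr1.
have rq1 : r ^+ q.+1 = `|a| `^ (q.+1%:R / q%:R).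
  by rewrite mulrC powRrM powR_mulrn.
have [a0|a0] := leP 0 a.
  by exists r; rewrite rq rq1 ger0_norm.
exists (- r); rewrite exprNn -signr_odd oq expr1 rq mulN1r ltr0_norm// opprK.
by rewrite exprNn -signr_odd/= oq expr0 mul1r -ltr0_norm.
Qed.

End lp_norms.

(** * Measurability and finite measure of compact sets in R^d *)

Section rV_measure.
Context {R : realType} {d : nat}.
Local Notation V := 'rV[R]_d.

Lemma measurable_rV_box (A : 'I_d -> set (measurableTypeR R)) :
  (forall i, measurable (A i)) -> measurable [set x : V | forall i, A i (x ord0 i)].
Proof.
move=> mA; have -> : [set x : V | forall i, A i (x ord0 i)] =
    \bigcap_(i in [set: 'I_d]) (rV_coord i @^-1` A i).
  by apply/seteqP; split => x /= Ax i => [_|]; exact: Ax.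
apply: fin_bigcap_measurable => // i _; rewrite -[X in measurable X]setTI.
exact: measurable_rV_coord.
Qed.

(** Each point of an open set lies in a box with rational corners inside the set, and such boxes are
    countably many. *)
Lemma open_measurable_rV (A : set V) : open A -> measurable A.
Proof.
move=> oA; pose box (ab : 'rV[rat]_d * 'rV[rat]_d) := [set x : V |
  forall i, `]ratr (ab.1 ord0 i), ratr (ab.2 ord0 i)[%classic (x ord0 i)].
(* Boxes not contained in [A] count as empty, so the union runs over a whole countable type. *)
pose F ab := if pselect (box ab `<=` A) then box ab else set0.
have -> : A = \bigcup_ab F ab.
  apply/seteqP; split => [x Ax|x [ab _]]; last first.
    by rewrite /F; case: pselect => // sub /sub.
  have /nbhs_ballP[e /= e0 sA] : nbhs x A by exact: open_nbhs_nbhs.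
  have /choice[a Ha] : forall i, exists q, ratr q \in `]x ord0 i - e, x ord0 i[.
    by move=> i; apply: rat_in_itvoo; rewrite ltrBlDr ltrDl.
  have /choice[b Hb] : forall i, exists q, ratr q \in `]x ord0 i, x ord0 i + e[.
    by move=> i; apply: rat_in_itvoo; rewrite ltrDl.
  exists (\row_i a i, \row_i b i) => //.
  rewrite /F; case: pselect => [_ i|].
    rewrite /= in_itv/= !mxE; move: (Ha i) (Hb i); rewrite !in_itv/=.
    by move=> /andP[_ ->] /andP[->].
  case=> y /= yab; apply: sA; split=> // j i; rewrite ord1.
  move: (yab i) (Ha i) (Hb i); rewrite /= !in_itv/= !mxE.
  move=> /andP[ay yb] /andP[xa _] /andP[_ bx].
  by rewrite /ball/= ltr_distlC (lt_trans xa ay) (lt_trans yb bx).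
apply: countable_bigcupT_measurable => [|ab]; first exact: countableP.
rewrite /F; case: pselect => ?; last exact: measurable0.
apply: (measurable_rV_box
  (fun i => `]ratr (ab.1 ord0 i), ratr (ab.2 ord0 i)[%classic)) => i.
exact: measurable_itv.
Qed.

Lemma compact_measurable_rV (A : set V) : compact A -> measurable A.
Proof.
move=> cA; rewrite -[A]setCK; apply: measurableC; apply: open_measurable_rV.
by apply: closed_openC; apply: compact_closed => //; exact: norm_hausdorff.
Qed.

(** A bounded set lies in a cube, whose measure is a finite product of finite lengths. *)
Lemma compact_lebesgue_rV_lty (A : set V) : compact A -> (lebesgue_rV d A < +oo)%E.
Proof.
move=> cA; have [M [_ HM]] := compact_bounded cA.
pose r := `|M| + 1; have Mr : M < r by rewrite ltr_pwDr// ler_norm.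
pose box := [set x : V | forall i : 'I_d, `[- r, r]%classic (x ord0 i)].
have sub : A `<=` box.
  move=> x Ax i /=; rewrite in_itv/= -ler_norml.
  apply: le_trans (HM r Mr x Ax).
  exact: ler_coord_norm.
have mI (i : 'I_d) : measurable (`[- r, r]%classic : set (measurableTypeR R)).
  exact: measurable_itv.
apply: (@le_lt_trans _ _ (lebesgue_rV d box)).
  apply: le_measure => //; rewrite inE; first exact: compact_measurable_rV.
  exact: measurable_rV_box mI.
rewrite (lebesgue_rV_box mI).
have [c ->] : exists c : R, lebesgue_measure (`[- r, r]%classic : set R) = c%:E.
  by rewrite lebesgue_measure_itv/=; case: ifP => _; [exists (r - - r)|exists 0].
by rewrite prodEFin ltry.
Qed.

End rV_measure.

(** * Mercer features and the uniqueness of coefficients *)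

Section mercer_features.
Context {R : realType} {d : nat}.
Local Notation V := 'rV[R]_d.
Variables (Omega : set V) (K : V -> V -> R) (lambda : nat -> R) (e : nat -> V -> R).
Hypothesis Omega_compact : compact Omega.
Hypothesis K_continuous : {within Omega `*` Omega, continuous (fun z => K z.1 z.2)}.
Hypothesis K_mercer : mercer_system Omega K lambda e.

Local Notation phi := (kernel_feature lambda e).
Local Notation mu := (lebesgue_rV d).

(** Uniform convergence, restricted to the singleton of [(z1, z2)], is pointwise convergence. *)
Lemma cvg_feature_mul {z1 z2 : V} : Omega z1 -> Omega z2 ->
  series (fun k => phi k z1 * phi k z2) @ \oo --> K z1 z2.
Proof.
move=> Oz1 Oz2.
have sub : [set (z1, z2)] `<=` Omega `*` Omega by move=> _ ->.
have := uniform_subset_cvg _ sub (mercer_uniform K_mercer).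
rewrite uniform_set1 /=.
have -> : series (fun k => phi k z1 * phi k z2) =
    (fun N => \sum_(k < N) lambda k * e k z1 * e k z2).
  apply/funext => N; rewrite /series/= big_mkord; apply: eq_bigr => k _.
  rewrite /kernel_feature mulrACA -expr2 sqr_sqrtr ?mulrA//.
  exact/ltW/(eigenvalue_gt0 K_mercer).
exact.
Qed.

Lemma diagonal_bounded : exists B, forall z, Omega z -> K z z <= B.
Proof.
have /compact_bounded[M [_ HM]] :=
  continuous_compact K_continuous (compact_setX Omega_compact Omega_compact).
exists (`|M| + 1) => z Oz; apply: le_trans (ler_norm _) _.
apply: HM; first by rewrite ltr_pwDr// ler_norm.
by exists (z, z).
Qed.

(** The square is one term of a nonnegative series with sum [K z z]. *)
Lemma feature_sqr_le {B : R} (z : V) (k : nat) :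
  (forall v, Omega v -> K v v <= B) ->
  Omega z -> phi k z ^+ 2 <= B.
Proof.
move=> KB Oz; apply: le_trans (KB z Oz).
have := cvg_series_ge_term k _ (cvg_feature_mul Oz Oz); apply => {}k.
by rewrite -expr2 sqr_ge0.
Qed.

Lemma features_separate (gamma : nat -> R) :
  cvgn (series (fun k => gamma k ^+ 2)) ->
  (forall z, Omega z -> series (fun k => gamma k * phi k z) @ \oo --> (0 : R)) ->
  forall j, gamma j = 0.
Proof.
move=> /cvg_ex[G cvgG] gamma0 j.
have [B KB] := diagonal_bounded.
have mO : measurable Omega by exact: compact_measurable_rV.
have Ofin : (mu Omega < +oo)%E by exact: compact_lebesgue_rV_lty.
have lambda0 k : 0 < lambda k := eigenvalue_gt0 K_mercer k.
have me k : measurable_fun Omega (e k) := (onb_L2 (eigenfun_basis K_mercer) k).1.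
(* The inequality |t| <= 1 + t^2 turns a bound on the square into one on the absolute value without
   a root. *)
have e_bound k z : Omega z -> `|e k z| <= 1 + B / lambda k.
  move=> Oz; have : e k z ^+ 2 <= B / lambda k.
    rewrite ler_pdivlMr// mulrC; have := feature_sqr_le z k KB Oz.
    by rewrite /kernel_feature exprMn sqr_sqrtr// ltW.
  rewrite -[_ ^+ 2]real_normK ?num_real//; have := sqr_ge0 (`|e k z| - 1).
  have := normr_ge0 (e k z); nra.
have int_ee k : mu.-integrable Omega (EFin \o (fun z => e k z * e j z)).
  apply: measurable_bounded_integrable => //; first exact: measurable_funM.
  exists ((1 + B / lambda k) * (1 + B / lambda j)); split; first exact: num_real.
  move=> r /ltW le_r z Oz; apply: le_trans le_r.
  by rewrite normrM ler_pM// e_bound.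
(* Partial sums of sum_k gamma_k phi_k, multiplied by e_j; orthonormality leaves only k = j in their
   integrals. *)
pose S N z := \sum_(k < N) (gamma k * Num.sqrt (lambda k)) * (e k z * e j z).
have int_S N : mu.-integrable Omega (EFin \o S N).
  rewrite (_ : EFin \o S N = fun z => \sum_(k < N)
    ((gamma k * Num.sqrt (lambda k))%:E * (e k z * e j z)%:E)%E).
    by apply: integrable_sum => // k _; apply: integrableZl => //; exact: int_ee.
  by apply/funext => z; rewrite /S/= -sumEFin; apply: eq_bigr => k _; rewrite EFinM.
have S_int N : \int[mu]_(z in Omega) S N z =
    \sum_(k < N) (gamma k * Num.sqrt (lambda k)) * ((k : nat) == j)%:R.
  elim: N => [|N IH].
    rewrite big_ord0 (_ : S 0%N = cst 0) ?Rintegral_cst ?mul0r//.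
    by apply/funext => z; rewrite /S big_ord0.
  rewrite big_ord_recr/= -IH -(onb_orthonormal (eigenfun_basis K_mercer)).
  rewrite -RintegralZl// -RintegralD//; last first.
    rewrite (_ : _ \o _ = fun z => ((gamma N * Num.sqrt (lambda N))%:E *
      (e N z * e j z)%:E)%E); first by apply: integrableZl => //; exact: int_ee.
    by apply/funext => z /=; rewrite EFinM.
  by apply: eq_Rintegral => z _; rewrite /S big_ord_recr.
have gammaSE N z : (S N z) = series (fun k => gamma k * phi k z) N * e j z.
  rewrite /series/= big_mkord mulr_suml; apply: eq_bigr => k _.
  by rewrite /kernel_feature; ring.
(* By |ab| <= a^2 + b^2 the partial sums split into a part at most [G] and a part at most
   [K z z <= B], uniformly in [N]. *)
have S_bound N z : Omega z -> `|S N z| <= (G + B) * (1 + B / lambda j).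
  move=> Oz; rewrite gammaSE normrM ler_pM ?e_bound//.
  apply: le_trans (ler_norm_sum _ _ _) _.
  apply: (@le_trans _ _ (series (fun k => gamma k ^+ 2 + phi k z ^+ 2) N)).
    apply: ler_sum => k _; rewrite normrM.
    rewrite -[gamma k ^+ 2]real_normK ?num_real// -[phi k z ^+ 2]real_normK ?num_real//.
    have := sqr_ge0 (`|gamma k| - `|phi k z|).
    have := normr_ge0 (gamma k); have := normr_ge0 (phi k z); nra.
  apply: (@le_trans _ _ (G + K z z)); last by rewrite lerD2l KB.
  have phi2 : series (fun k => phi k z ^+ 2) @ \oo --> K z z.
    by have := cvg_feature_mul Oz Oz; apply: eq_cvg_series => k; rewrite expr2.
  have cvgS := cvg_seriesD cvgG phi2.
  rewrite -(cvg_lim _ cvgS)//; apply: nondecreasing_cvgn_le; last exact: cvgP cvgS.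
  by apply: nondecreasing_series => k _ _; rewrite addr_ge0 ?sqr_ge0.
(* The majorant is constant, hence integrable because [Omega] has finite measure. *)
have S_lim : (\int[mu]_(z in Omega) (S N z)%:E)%E @[N --> \oo] --> 0%E.
  rewrite -[X in _ --> X](integral0 mu Omega).
  apply: (@dominated_cvg _ _ _ mu Omega mO (fun N z => (S N z)%:E) (fun=> 0%E)
    (cst ((G + B) * (1 + B / lambda j))%:E)) => //.
  - by move=> N; have /integrableP[] := int_S N.
  - move=> z Oz; apply: cvg_EFin; first exact: nearW.
    have -> : fine \o (fun N => (S N z)%:E) =
        (fun N => series (fun k => gamma k * phi k z) N * e j z).
      by apply/funext => N /=; rewrite gammaSE.
    by rewrite -[X in _ --> X](mul0r (e j z)); apply: cvgM (gamma0 z Oz) (cvg_cst _).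
  - rewrite (_ : cst _ = EFin \o cst ((G + B) * (1 + B / lambda j)))//.
    by apply: measurable_bounded_integrable => //; exact: bounded_cst.
have S_val N : (j < N)%N ->
    (\int[mu]_(z in Omega) (S N z)%:E)%E = (gamma j * Num.sqrt (lambda j))%:E.
  move=> jN; rewrite -[LHS]fineK; last exact: (integrable_fin_num mO (int_S N)).
  congr EFin; rewrite -[LHS]/(\int[mu]_(z in Omega) S N z) S_int.
  rewrite (bigD1 (Ordinal jN))//= eqxx mulr1 big1 ?addr0// => k kj.
  by move: kj; rewrite -val_eqE/= => /negbTE ->; rewrite mulr0.
have : 0%E = (gamma j * Num.sqrt (lambda j))%:E.
  apply: cvg_unique S_lim _ => //.
  (* From N = j + 1 on, the index [j] belongs to the partial sum and the integral is constant. *)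
  apply: cvg_near_cst; exists j.+1 => // N /= jN; exact: S_val.
by move=> [] /esym/eqP; rewrite mulf_eq0 sqrtr_eq0 leNgt lambda0 orbF => /eqP.
Qed.

End mercer_features.

(** * Powers with the exponent p = (q+1)/q *)

Section conjugate_power.
Context {R : realType} {q : nat}.
Hypothesis q_odd : odd q.
Local Notation p := (q.+1%:R / q%:R : R).

Lemma conj_exponent_gt0 : 0 < p.
Proof. by rewrite divr_gt0 ?ltr0n// odd_gt0. Qed.

Lemma powR_pow_conj (u : R) : `|u ^+ q| `^ p = u ^+ q.+1.
Proof.
have q0 : (q%:R : R) != 0 by rewrite pnatr_eq0 -lt0n odd_gt0.
rewrite normrX -(powR_mulrn q (normr_ge0 u)) -powRrM mulrCA divff// mulr1 powR_mulrn//.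
by rewrite -normrX ger0_norm// exprn_even_ge0//= negbK.
Qed.

(** Each |alpha_k|^p is at most the sum [N], so a^2 <= (1 + |a|^p) |a|^p suffices; this holds
    because p <= 2 <= 2p. *)
Lemma lp_sqr_summable {alpha : nat -> R} :
  cvgn (series (fun k => `|alpha k| `^ p)) -> cvgn (series (fun k => alpha k ^+ 2)).
Proof.
move=> /cvg_ex[N aN].
apply: (is_cvg_series_le _ (cvgP _ (cvg_seriesZ (1 + N) aN))) => k.
rewrite ger0_norm ?sqr_ge0//.
have aNk : `|alpha k| `^ p <= N.
  by apply: (cvg_series_ge_term k _ aN) => j; exact: powR_ge0.
apply: (@le_trans _ _ ((1 + `|alpha k| `^ p) * `|alpha k| `^ p)); last first.
  by rewrite ler_wpM2r ?powR_ge0// lerD2l.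
have [w [<- wp]] := odd_root (alpha k) q_odd.
rewrite powR_pow_conj; move: q_odd; case: (q) => // r /=; rewrite -exprM => r_even.
(* With alpha_k = w^(r+1), cancelling w^(r+2) leaves w^r <= 1 + w^(r+2), which is checked for |w| <=
   1 and |w| >= 1 separately. *)
have -> : (r.+1 * 2 = r + r.+2)%N by rewrite muln2 -addnn addSnnS.
rewrite exprD ler_wpM2r//; first by rewrite exprn_even_ge0//= negbK.
have -> : w ^+ r = `|w| ^+ r by rewrite -normrX ger0_norm// exprn_even_ge0.
have -> : w ^+ r.+2 = `|w| ^+ r.+2.
  by rewrite -normrX ger0_norm// exprn_even_ge0//= negbK.
have [w1|/ltW w1] := leP `|w| 1.
  by rewrite (le_trans (exprn_ile1 _ (normr_ge0 w) w1))// lerDl exprn_ge0.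
by rewrite (le_trans (ler_weXn2l w1 (_ : (r <= r.+2)%N))) ?lerDr// leqW.
Qed.

End conjugate_power.

(** * Norm-minimal interpolation in the kernel Banach space *)

Section interpolation.
Context {R : realType} {d : nat}.
Local Notation V := 'rV[R]_d.
Variables (Omega : set V) (K : V -> V -> R) (lambda : nat -> R) (e : nat -> V -> R).
Hypothesis Omega_compact : compact Omega.
Hypothesis K_admissible : admissible_kernel Omega K.
Hypothesis K_mercer : mercer_system Omega K lambda e.
Local Notation phi := (kernel_feature lambda e).
Variable q : nat.
Hypothesis q_odd : odd q.
Local Notation p := (q.+1%:R / q%:R : R).

Lemma kernel_coef_unique {g : V -> R} {alpha beta : nat -> R} :
  kernel_coef Omega phi p g alpha -> kernel_coef Omega phi p g beta -> alpha = beta.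
Proof.
move=> [ap ag] [bp bg]; apply/funext => j; apply/eqP; rewrite -subr_eq0; apply/eqP.
have p0 := @conj_exponent_gt0 R q q_odd.
have /cvg_ex[M aM] := lp_sqr_summable q_odd (lp_norm_lty p0 ap).
have /cvg_ex[N bN] := lp_sqr_summable q_odd (lp_norm_lty p0 bp).
apply: (features_separate Omega K lambda e Omega_compact
  (kernel_continuous K_admissible) K_mercer (fun k => alpha k - beta k)) => [|z Oz].
  (* The majorant comes from (a - b)^2 <= 2 a^2 + 2 b^2. *)
  have sumMN := cvg_seriesD (cvg_seriesZ 2 aM) (cvg_seriesZ 2 bN).
  apply: (is_cvg_series_le _ (cvgP _ sumMN)) => k.
  rewrite ger0_norm ?sqr_ge0//; have := sqr_ge0 (alpha k + beta k); lra.
rewrite -(subrr (g z)); have := cvg_seriesB (ag z Oz) (bg z Oz).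
by apply: eq_cvg_series => k; rewrite mulrBl.
Qed.

(** Uniqueness of coefficients makes the choice inside [kernel_norm] immaterial. *)
Lemma kernel_normE {g : V -> R} {alpha : nat -> R} {l : R} :
  kernel_coef Omega phi p g alpha ->
  series (fun k => `|alpha k| `^ p) @ \oo --> l ->
  kernel_norm Omega phi p g = l `^ p^-1.
Proof.
move=> ag al; rewrite /kernel_norm.
have -> : xget (fun=> 0) [set alpha | kernel_coef Omega phi p g alpha] = alpha.
  exact: (kernel_coef_unique (xgetI (fun=> 0) ag) ag).
by rewrite (lp_normE (@conj_exponent_gt0 R q q_odd) al).
Qed.

Context {n : nat}.
Variable x : 'I_n -> V.
Hypothesis x_Omega : forall i, Omega (x i).
Hypothesis x_inj : injective x.
Hypothesis phi_summable : forall z, Omega z -> absolutely_summable_at phi z.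

Local Notation u := (lincomb (fun k i => phi k (x i))).
Local Notation P := (tensor_apply (kernel_tensor phi x (m := q.+1))).

(** The quadratic form of [K] at the points [x i] equals sum_k u_k(c)^2, and positive definiteness
    forbids the value 0 for nonzero [c]. *)
Lemma lincomb_feature_inj (c : 'rV[R]_n) : (forall k, u c k = 0) -> c = 0.
Proof.
move=> uc; apply/eqP; apply: contraT => c0.
have := kernel_posdef K_admissible x_Omega x_inj c0.
suff -> : \sum_(i < n) \sum_(j < n) K (x i) (x j) * c ord0 i * c ord0 j = 0.
  by rewrite ltxx.
have cvgK : series (fun k => \sum_(i < n) \sum_(j < n)
    c ord0 i * c ord0 j * (phi k (x i) * phi k (x j))) @ \oo -->
    \sum_(i < n) \sum_(j < n) c ord0 i * c ord0 j * K (x i) (x j).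
  apply: cvg_series_sum => i; apply: cvg_series_sum => j; apply: cvg_seriesZ.
  exact: (cvg_feature_mul Omega K lambda e K_mercer).
have cvg0 : series (fun k => \sum_(i < n) \sum_(j < n)
    c ord0 i * c ord0 j * (phi k (x i) * phi k (x j))) @ \oo --> (0 : R).
  rewrite (_ : series _ = cst 0); first exact: cvg_cst.
  apply/funext => N; rewrite /series/= big1// => k _.
  transitivity (u c k * u c k); last by rewrite uc mul0r.
  rewrite /lincomb mulr_suml; apply: eq_bigr => i _.
  by rewrite mulr_sumr; apply: eq_bigr => j _; ring.
apply: (etrans _ (cvg_series_unique cvgK cvg0)).
by apply: eq_bigr => i _; apply: eq_bigr => j _; ring.
Qed.

Lemma cvg_tensor_apply (c : 'rV[R]_n) (i : 'I_n) :
  series (fun k => phi k (x i) * u c k ^+ q) @ \oo --> P c ord0 i.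
Proof.
rewrite tensor_applyE; apply: cvg_tensor_contract => [j|]; exact/phi_summable.
Qed.

Lemma tensor_apply_continuous (i : 'I_n) : continuous (fun c => P c ord0 i).
Proof.
rewrite (_ : (fun c => _) = tensor_contract (kernel_row_tensor phi x (x i) (q := q))).
  exact: tensor_contract_continuous.
by apply/funext => c; rewrite tensor_applyE.
Qed.

(** Since |u^q|^p = u^(q+1), the p-th power of the norm of the interpolant is the energy of [c]. *)
Lemma kernel_coef_interpolant (c : 'rV[R]_n) :
  kernel_coef Omega phi p (interpolant phi x q.+1 c) (fun k => u c k ^+ q) /\
  series (fun k => `|u c k ^+ q| `^ p) @ \oo --> row_dot (P c) c.
Proof.
have cvgN : series (fun k => `|u c k ^+ q| `^ p) @ \oo --> row_dot (P c) c.
  have := cvg_row_dot _ _ cvg_tensor_apply c c; apply: eq_cvg_series => k.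
  by rewrite powR_pow_conj// exprS.
split=> //; split=> [|z Oz].
  by rewrite (lp_normE (@conj_exponent_gt0 R q q_odd) cvgN) ltry.
have x_summable i := phi_summable (x i) (x_Omega i).
have := cvg_tensor_contract phi x x_summable z q c (phi_summable z Oz).
by apply: eq_cvg_series => k; rewrite mulrC.
Qed.

Lemma interpolation_energy_le (c : 'rV[R]_n) (h : V -> R) (beta : nat -> R) (l : R) :
  kernel_coef Omega phi p h beta -> (forall i, h (x i) = P c ord0 i) ->
  series (fun k => `|beta k| `^ p) @ \oo --> l ->
  row_dot (P c) c <= l /\
  (l <= row_dot (P c) c -> beta = (fun k => u c k ^+ q)).
Proof.
move=> [_ bh] hx bl; set N := row_dot (P c) c.
have /choice[w Hw] := fun k => odd_root (beta k) q_odd.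
have cvg_bu : series (fun k => beta k * u c k) @ \oo --> N.
  have := cvg_series_sum (index_enum _)
    (fun i => cvg_seriesZ (c ord0 i) (bh _ (x_Omega i))).
  under [X in _ --> X]eq_bigr do rewrite hx.
  apply: eq_cvg_series => k; rewrite /lincomb mulr_sumr; apply: eq_bigr => i _; ring.
have cvg_uq : series (fun k => u c k * u c k ^+ q) @ \oo --> N.
  exact: cvg_row_dot cvg_tensor_apply _ _.
(* The gap expands to u^(q+1) + q w^(q+1) - (q+1) w^q u; the three series sum to [N], q l and (q+1)
   N. *)
have cvg_gap : series (fun k => tangent_gap q (u c k) (w k)) @ \oo --> q%:R * (l - N).
  have -> : q%:R * (l - N) = N + q%:R * l - q.+1%:R * N by rewrite -natr1; ring.
  have := cvg_seriesB (cvg_seriesD cvg_uq (cvg_seriesZ q%:R bl))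
    (cvg_seriesZ q.+1%:R cvg_bu).
  apply: eq_cvg_series => k; have [wb wp] := Hw k.
  by rewrite -wp -wb /tangent_gap !exprS -natr1; ring.
have gap0 k : 0 <= tangent_gap q (u c k) (w k) by exact: tangent_gap_ge0.
have q0 : (0 : R) < q%:R by rewrite ltr0n odd_gt0.
have Nl : N <= l by have := cvg_series_ge0 gap0 cvg_gap; rewrite pmulr_rge0// subr_ge0.
split=> // lN; apply/funext => k; have {lN Nl}lN : l = N by apply/le_anti; rewrite lN.
move: cvg_gap; rewrite lN subrr mulr0 => /(cvg_series_eq0 gap0)/(_ k).
by move=> /(tangent_gap_eq0 q_odd) ->; have [] := Hw k.
Qed.

(** With the data written as [P c] the interpolant is visibly feasible. Norms are compared through
    their p-th powers, t^(1/p) being increasing for t >= 0. *)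
Lemma interpolant_norm_minimal (c : 'rV[R]_n) :
  unique_norm_minimal Omega phi p x (P c) (interpolant phi x q.+1 c).
Proof.
set s := interpolant phi x q.+1 c; have [sa aN] := kernel_coef_interpolant c.
have p0 := @conj_exponent_gt0 R q q_odd.
have ip0 : 0 < p^-1 by rewrite invr_gt0.
have N0 : row_dot (P c) c \in Num.nneg.
  by rewrite nnegrE; apply: (cvg_series_ge0 _ aN) => k; exact: powR_ge0.
have s_feasible : interpolation_feasible Omega phi p x (P c) s.
  by split=> [|i]; [eexists; exact: sa|rewrite tensor_applyE].
have competitor h : interpolation_feasible Omega phi p x (P c) h ->
    exists beta l, [/\ kernel_coef Omega phi p h beta, l \in Num.nneg,
      kernel_norm Omega phi p h = l `^ p^-1, row_dot (P c) c <= l &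
      l <= row_dot (P c) c -> beta = (fun k => u c k ^+ q)].
  move=> [[beta hb] hx]; have /cvg_ex[l bl] := lp_norm_lty p0 hb.1.
  have [Nl lN] := interpolation_energy_le c h beta l hb hx bl.
  exists beta, l; split=> //; last exact: kernel_normE hb bl.
  by rewrite nnegrE; apply: (cvg_series_ge0 _ bl) => k; exact: powR_ge0.
have sE := kernel_normE sa aN.
split=> [|g [g_feasible g_min] z Oz].
  split=> // h /competitor[beta [l [_ l0 -> Nl _]]].
  by rewrite sE ge0_ler_powR// ltW.
have [beta [l [gb l0 gE Nl betaE]]] := competitor g g_feasible.
(* If [l] exceeded the energy of [c], the norm of [g] would be strictly larger than that of [s],
   against the minimality of [g]. *)
have bE : beta = (fun k => u c k ^+ q).
  apply: betaE; rewrite leNgt; apply/negP => /(gt0_ltr_powR ip0 N0 l0).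
  by rewrite -gE -sE ltNge g_min.
apply: cvg_series_unique (gb.2 z Oz) _; rewrite bE; exact: sa.2.
Qed.

End interpolation.

Theorem theorem4p3 (R : realType) (d : nat) (Omega : set 'rV[R]_d)
    (Phi2 : 'rV[R]_d -> 'rV[R]_d -> R)
    (lambda : nat -> R) (e : nat -> 'rV[R]_d -> R)
    (Omega_compact : compact Omega)
    (Phi2_kernel : admissible_kernel Omega Phi2)
    (Phi2_mercer : mercer_system Omega Phi2 lambda e)
    (phi_summable : forall x, Omega x ->
       cvgn (series (fun k => `|kernel_feature lambda e k x|)))
    (m : nat) (m_gt0 : (0 < m)%N) (m_even : ~~ odd m)
    (n : nat) (n_gt0 : (0 < n)%N)
    (x : 'I_n -> 'rV[R]_d)
    (x_Omega : forall i, Omega (x i)) (x_inj : injective x)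
    (f : 'rV[R]_d -> R) (f_continuous : {within Omega, continuous f}) :
  let phi := kernel_feature lambda e in
  let y : 'rV[R]_n := \row_i f (x i) in
  exists c : 'rV[R]_n,
    unique (fun c' => tensor_apply (kernel_tensor phi x (m := m.-1.+1)) c' = y) c /\
    unique_norm_minimal Omega phi (m%:R / m.-1%:R) x y (interpolant phi x m c).
Proof.
(* Write m = q + 1; evenness of m makes [q] odd, so the denominator of the exponent is nonzero. *)
move=> phi y; case: m m_gt0 m_even => // q _; rewrite negbK => q_odd.
have u_inj := lincomb_feature_inj Omega Phi2 lambda e
  Phi2_kernel Phi2_mercer x x_Omega x_inj.
have P_cvg := cvg_tensor_apply Omega lambda e q x x_Omega phi_summable.
have P_cont := tensor_apply_continuous lambda e q x.
have [c Pc] := power_system_solvable _ _ q_odd u_inj P_cvg P_cont y.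
exists c; split.
  split=> // c' Pc'; apply: (power_system_unique _ _ q_odd u_inj P_cvg).
  by rewrite Pc Pc'.
rewrite -Pc.
exact: (interpolant_norm_minimal Omega Phi2 lambda e Omega_compact Phi2_kernel).
Qed.
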